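(* Let $\mathcal{H}$ be a separable complex Hilbert space. If $T \in B(\mathcal{H})$ is algebraic of degree at most $2$, then $T$ is a complex symmetric operator. Moreover, this is sharp: for each finite integer $n \geq 3$ and each separable complex Hilbert space $\mathcal{H}$ with $\dim \mathcal{H} \geq n$, there exists an algebraic operator on $\mathcal{H}$ of degree $n$ that is not a complex symmetric operator.
   Context: An operator $T\in B(\mathcal{H})$ is algebraic if $p(T)=0$ for some nonzero polynomial $p$; its degree is the least degree of such a polynomial. A conjugation on $\mathcal{H}$ is a conjugate-linear map $C:\mathcal{H}\to\mathcal{H}$ that is isometric and involutive ($C^2=I$). An operator $T$ is complex symmetric if $T = CT^*C$ for some conjugation $C$. *)

(* Defs.v *)
(* mathcomp 2.5 + mathcomp-analysis [reals] + mathcomp-real-closed [complex]. *)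
From mathcomp Require Import all_boot all_order all_algebra.
From mathcomp Require Export reals complex.
Set Implicit Arguments. Unset Strict Implicit. Unset Printing Implicit Defensive.
Import Order.TTheory GRing.Theory Num.Theory.
Local Open Scope ring_scope.

(* Complex scalars are R[i] for R : realType (any realType is isomorphic to the reals). *)

Section Hilbert.
Variable R : realType.
Variable V : lmodType R[i].
Variable ip : V -> V -> R[i].   (* inner product, linear in the first argument *)

Definition inner_product_axioms : Prop :=
  [/\ (forall (a : R[i]) (x y z : V), ip (a *: x + y) z = a * ip x z + ip y z),
      (forall x y : V, ip y x = (ip x y)^*),
      (forall x : V, 0 <= ip x x) &
      (forall x : V, ip x x = 0 -> x = 0)].

(* induced norm ||x|| = sqrt <x,x> *)
Definition hnorm (x : V) : R := Num.sqrt (complex.Re (ip x x)).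

Definition hcauchy (u : nat -> V) : Prop :=
  forall eps : R, 0 < eps -> exists N : nat,
    forall m k : nat, (N <= m)%N -> (N <= k)%N -> hnorm (u m - u k) < eps.

Definition hconverges (u : nat -> V) : Prop :=
  exists l : V, forall eps : R, 0 < eps -> exists N : nat,
    forall m : nat, (N <= m)%N -> hnorm (u m - l) < eps.

Definition hcomplete : Prop := forall u : nat -> V, hcauchy u -> hconverges u.

(* separable: has a countable dense subset (enumerated by a sequence) *)
Definition hseparable : Prop :=
  exists d : nat -> V, forall (x : V) (eps : R), 0 < eps ->
    exists n : nat, hnorm (x - d n) < eps.

(* separable complex Hilbert space structure given by ip *)
Definition separable_hilbert : Prop :=
  [/\ inner_product_axioms, hcomplete & hseparable].

(* dim H >= n : H contains n linearly independent vectors *)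
Definition dim_ge (n : nat) : Prop :=
  exists v : 'I_n -> V, forall c : 'I_n -> R[i],
    \sum_(i < n) c i *: v i = 0 -> forall i, c i = 0.

(* bounded linear operators B(H) *)
Definition bounded_linear (T : V -> V) : Prop :=
  (forall (a : R[i]) (x y : V), T (a *: x + y) = a *: T x + T y) /\
  exists M : R, forall x : V, hnorm (T x) <= M * hnorm x.

(* p(T) applied to x *)
Definition poly_op (p : {poly R[i]}) (T : V -> V) (x : V) : V :=
  \sum_(i < size p) p`_i *: iter i T x.

Definition annihilates (p : {poly R[i]}) (T : V -> V) : Prop :=
  forall x : V, poly_op p T x = 0.

Definition algebraic (T : V -> V) : Prop :=
  exists p : {poly R[i]}, p != 0 /\ annihilates p T.

(* T is algebraic and its degree (least degree of a nonzero annihilating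
   polynomial) is n *)
Definition algebraic_of_degree (T : V -> V) (n : nat) : Prop :=
  (exists p : {poly R[i]}, p != 0 /\ annihilates p T /\ (size p).-1 = n) /\
  (forall q : {poly R[i]}, q != 0 -> annihilates q T -> (n <= (size q).-1)%N).

(* T is algebraic of degree at most n *)
Definition algebraic_degree_le (T : V -> V) (n : nat) : Prop :=
  exists p : {poly R[i]}, p != 0 /\ annihilates p T /\ ((size p).-1 <= n)%N.

(* S is the adjoint T^* of T *)
Definition is_adjoint (T S : V -> V) : Prop :=
  forall x y : V, ip (T x) y = ip x (S y).

(* conjugation: conjugate-linear, isometric, involutive *)
Definition conjugation (C : V -> V) : Prop :=
  [/\ (forall (a : R[i]) (x y : V), C (a *: x + y) = a^* *: C x + C y),
      (forall x : V, hnorm (C x) = hnorm x) &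
      (forall x : V, C (C x) = x)].

(* T = C T^* C for some conjugation C *)
Definition complex_symmetric (T : V -> V) : Prop :=
  exists C : V -> V, conjugation C /\
    exists S : V -> V, is_adjoint T S /\ forall x : V, T x = C (S (C x)).

End Hilbert.

(* Main.v *)
Require Import Defs.
From mathcomp Require Import all_boot all_order all_algebra.
From mathcomp Require Import reals complex.
From mathcomp Require Import ring lra boolp classical_sets.
Import Order.TTheory GRing.Theory Num.Theory.
Local Open Scope ring_scope.
Set Implicit Arguments. Unset Strict Implicit. Unset Printing Implicit Defensive.

(** An algebraic operator of degree at most 2 becomes, after an affine change
    a T + b, an operator whose square is a real multiple of the identity.
    Its real and imaginary parts X and Y are then self-adjoint and anticommute,
    and it suffices to find a conjugation commuting with both.  By Zorn's lemma
    there is a maximal set G on which all numbers <w g, h>, w a word in X and Y,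
    are real; G is a closed real subspace stable under X and Y.  If V = G + iG,
    then l + ik |-> l - ik is the conjugation.  Otherwise take u <> 0 orthogonal
    to G and let Q = |X|: one of Xu + Qu, Xu - Qu, u is a nonzero vector e with
    X e = s Q e, s in {1, -1, 0}.  Each word then maps e to a real multiple of
    some Q^j Y^k e with Q and Y commuting, so all <w e, e> are real,
    contradicting maximality.

    For sharpness, take the nilpotent weighted shift e_(k+1) |-> w_k e_k on n
    orthonormal vectors, extended by 0, with w_0 = 2 and all other weights 1.  A
    conjugation C with T = C T^* C maps e_0 to a unimodular multiple of
    e_(n-1), so that |T^* e_0| = 2 and |T e_(n-1)| = 1 would agree. *)

(** * Scalar preliminaries *)

Lemma conjE (R : realType) (z : R[i]) : z^* = conjc z.
Proof. reflexivity. Qed.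

Lemma Re_norm_ge0 (R : realType) (z : R[i]) : 0 <= complex.Re `|z|.
Proof. by have := normr_ge0 z; rewrite lecE => /andP[]. Qed.

Lemma Re_norm_le0 (R : realType) (z : R[i]) : complex.Re `|z| <= 0 -> z = 0.
Proof.
move=> z_le; apply/eqP; rewrite -normr_eq0 eq_complex eq_le z_le Re_norm_ge0 /=.
by apply/eqP.
Qed.

Lemma natSinv_lt (R : realType) (eps : R) : 0 < eps ->
  exists N, forall n, (N <= n)%N -> n.+1%:R^-1 < eps.
Proof.
move=> e0; exists (Num.bound eps^-1) => n le_n.
rewrite -[ltRHS]invrK ltf_pV2 ?posrE ?invr_gt0 ?ltr0n //.
apply: lt_trans (archi_boundP _) _; first by rewrite invr_ge0 ltW.
by rewrite ltr_nat ltnS.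
Qed.

(** * Inner products, norms and limits *)

Section InnerProduct.
Variables (R : realType) (V : lmodType R[i]) (ip : V -> V -> R[i]).
Hypothesis ipP : inner_product_axioms ip.

Local Notation nm := (hnorm ip).
Local Notation rC a := (a%:C%C).

Lemma ipC x y : ip y x = (ip x y)^*. Proof. by case: ipP. Qed.

Lemma ipDl x y z : ip (x + y) z = ip x z + ip y z.
Proof. by case: ipP => H _ _ _; have := H 1 x y z; rewrite scale1r mul1r. Qed.

Lemma ip0l z : ip 0 z = 0.
Proof. by apply: (@addrI _ (ip 0 z)); rewrite -ipDl !addr0. Qed.

Lemma ipZl a x z : ip (a *: x) z = a * ip x z.
Proof. by case: ipP => H _ _ _; have := H a x 0 z; rewrite ip0l !addr0. Qed.

Lemma ipNl x z : ip (- x) z = - ip x z.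
Proof. by rewrite -scaleN1r ipZl mulN1r. Qed.

Lemma ipBl x y z : ip (x - y) z = ip x z - ip y z.
Proof. by rewrite ipDl ipNl. Qed.

Lemma ipDr x y z : ip z (x + y) = ip z x + ip z y.
Proof. by rewrite ipC ipDl rmorphD /= -!ipC. Qed.

Lemma ip0r z : ip z 0 = 0.
Proof. by rewrite ipC ip0l rmorph0. Qed.

Lemma ipZr a x z : ip z (a *: x) = a^* * ip z x.
Proof. by rewrite ipC ipZl rmorphM /= -ipC. Qed.

Lemma ipNr x z : ip z (- x) = - ip z x.
Proof. by rewrite ipC ipNl rmorphN /= -ipC. Qed.

Lemma ipBr x y z : ip z (x - y) = ip z x - ip z y.
Proof. by rewrite ipDr ipNr. Qed.

Lemma ip_suml (I : finType) (P : pred I) (F : I -> V) z :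
  ip (\sum_(i | P i) F i) z = \sum_(i | P i) ip (F i) z.
Proof. exact: (big_morph (ip^~ z) (fun x y => ipDl x y z) (ip0l z)). Qed.

(** This makes [V] a real inner product space, the setting in which real subspaces have orthogonal
    projections. *)
Definition re_ip x y : R := complex.Re (ip x y).
Local Notation rip := re_ip.

Lemma ReD (a b : R[i]) : complex.Re (a + b) = complex.Re a + complex.Re b.
Proof. by case: a b => [? ?] [? ?]. Qed.

Lemma ReN (a : R[i]) : complex.Re (- a) = - complex.Re a.
Proof. by case: a. Qed.

Lemma ImD (a b : R[i]) : complex.Im (a + b) = complex.Im a + complex.Im b.
Proof. by case: a b => [? ?] [? ?]. Qed.

Lemma ReZ (a : R) (b : R[i]) : complex.Re (rC a * b) = a * complex.Re b.
Proof. by case: b => c d /=; rewrite mul0r subr0. Qed.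

Lemma ImZ (a : R) (b : R[i]) : complex.Im (rC a * b) = a * complex.Im b.
Proof. by case: b => c d /=; rewrite mul0r addr0. Qed.

Lemma ripC x y : rip x y = rip y x.
Proof. by rewrite /re_ip (ipC y x); case: (ip y x). Qed.

Lemma ripDl x y z : rip (x + y) z = rip x z + rip y z.
Proof. by rewrite /re_ip ipDl ReD. Qed.

Lemma ripDr x y z : rip z (x + y) = rip z x + rip z y.
Proof. by rewrite !(ripC z) ripDl. Qed.

Lemma ripZl a x z : rip (rC a *: x) z = a * rip x z.
Proof. by rewrite /re_ip ipZl ReZ. Qed.

Lemma ripZr a x z : rip z (rC a *: x) = a * rip z x.
Proof. by rewrite !(ripC z) ripZl. Qed.

Lemma ripNl x z : rip (- x) z = - rip x z.
Proof. by rewrite /re_ip ipNl ReN. Qed.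

Lemma ripNr x z : rip z (- x) = - rip z x.
Proof. by rewrite !(ripC z) ripNl. Qed.

Definition ripE := (ripDl, ripDr, ripNl, ripNr, ripZl, ripZr).

(** Imaginary parts become values of [re_ip], so facts proved for the real product carry over to
    [ip]. *)
Lemma ripi x y : rip ('i%C *: x) y = - complex.Im (ip x y).
Proof. by rewrite /re_ip ipZl mulrC ReiNIm. Qed.

Lemma rip_ge0 x : 0 <= rip x x.
Proof. by case: ipP => _ _ + _ => /(_ x); rewrite lecE => /andP[]. Qed.

Lemma ipxxE x : ip x x = rC (rip x x).
Proof.
case: ipP => _ _ + _ => /(_ x) /ger0_Im; rewrite /re_ip.
by case: (ip x x) => a b /= ->.
Qed.

Lemma rip_eq0 x : rip x x = 0 -> x = 0.
Proof. by move=> x0; case: ipP => _ _ _; apply; rewrite ipxxE x0. Qed.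

Lemma rip_gt0 x : x <> 0 -> 0 < rip x x.
Proof.
move=> x0; rewrite lt_def rip_ge0 andbT; apply/eqP => /rip_eq0; exact: x0.
Qed.

Lemma nm_ge0 x : 0 <= nm x. Proof. exact: sqrtr_ge0. Qed.

Lemma nm2 x : nm x ^+ 2 = rip x x. Proof. by rewrite sqr_sqrtr ?rip_ge0. Qed.

Lemma nm0 : nm 0 = 0. Proof. by rewrite /hnorm ip0l sqrtr0. Qed.

Lemma nm_eq0 x : nm x = 0 -> x = 0.
Proof. by move=> x0; apply: rip_eq0; rewrite -nm2 x0 expr0n. Qed.

Lemma nm_le x a : 0 <= a -> rip x x <= a ^+ 2 -> nm x <= a.
Proof. by move=> a0; rewrite -nm2 ler_pXn2r ?nnegrE ?nm_ge0. Qed.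

Lemma nm_lt x a : 0 <= a -> rip x x < a ^+ 2 -> nm x < a.
Proof. by move=> a0; rewrite -nm2 ltr_pXn2r ?nnegrE ?nm_ge0. Qed.

Lemma rip_CS2 x y : rip x y ^+ 2 <= rip x x * rip y y.
Proof.
have [->|/eqP y0] := eqVneq y 0.
  by rewrite /re_ip !ip0r /= mulr0 expr0n.
have yy := rip_gt0 y0.
have := rip_ge0 (rC (rip y y) *: x - rC (rip x y) *: y).
rewrite !ripE (ripC y x) => H.
have {H}: 0 <= rip y y * (rip x x * rip y y - rip x y ^+ 2) by nra.
by rewrite pmulr_rge0 // subr_ge0.
Qed.

Lemma rip_CS x y : `|rip x y| <= nm x * nm y.
Proof.
rewrite -(@ler_pXn2r _ 2) ?nnegrE ?mulr_ge0 ?nm_ge0 //.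
by rewrite real_normK ?num_real // exprMn !nm2 rip_CS2.
Qed.

Lemma nmD x y : nm (x + y) <= nm x + nm y.
Proof.
apply: nm_le; first by rewrite addr_ge0 ?nm_ge0.
rewrite !ripE (ripC y x) sqrrD !nm2.
by have := rip_CS x y; rewrite ler_norml => /andP[_]; lra.
Qed.

Lemma nmZ a x : nm (rC a *: x) = `|a| * nm x.
Proof.
apply/eqP; rewrite -(@eqrXn2 _ 2) ?mulr_ge0 ?nm_ge0 //.
by rewrite exprMn !nm2 !ripE real_normK ?num_real // mulrA.
Qed.

Lemma nmN x : nm (- x) = nm x.
Proof. by rewrite /hnorm ipNl ipNr opprK. Qed.

Lemma nmBC x y : nm (x - y) = nm (y - x).
Proof. by rewrite -nmN opprB. Qed.

Lemma nmZC (a : R[i]) x : nm (a *: x) = complex.Re `|a| * nm x.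
Proof.
apply/eqP; rewrite -(@eqrXn2 _ 2) ?mulr_ge0 ?nm_ge0 ?Re_norm_ge0 //.
rewrite exprMn !nm2 /re_ip ipZl ipZr mulrA -sqr_normc ipxxE /=.
by rewrite !mulr0 !subr0 expr2.
Qed.

Definition lim (u : nat -> V) (l : V) := forall eps : R, 0 < eps ->
  exists N : nat, forall m : nat, (N <= m)%N -> nm (u m - l) < eps.

(** Identities between inner products pass to limits through this bound. [K] and [K'] may have any
    sign, so the two distances are made smaller than r/2 divided by |K| + 1 and |K'| + 1. *)
Lemma lim_le0_2 u l v k r K K' : lim u l -> lim v k ->
  (forall n, r <= K * nm (u n - l) + K' * nm (v n - k)) -> r <= 0.
Proof.
move=> ul vk H; rewrite leNgt; apply/negP => r0.
have pos (L : R) : 0 < `|L| + 1 by rewrite ltr_wpDl.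
have r2 : 0 < r / 2 by lra.
have [N hN] := ul _ (divr_gt0 r2 (pos K)).
have [M hM] := vk _ (divr_gt0 r2 (pos K')).
have {}hN := hN _ (leq_maxl N M); have {}hM := hM _ (leq_maxr N M).
have aux (L s : R) : 0 <= s -> s < r / 2 / (`|L| + 1) -> L * s < r / 2.
  move=> s0; rewrite ltr_pdivlMr // mulrC; apply: le_lt_trans.
  by rewrite ler_wpM2r //; apply: le_trans (ler_norm _) _; rewrite lerDl.
have := H (maxn N M).
have := aux _ _ (nm_ge0 _) hN; have := aux _ _ (nm_ge0 _) hM; lra.
Qed.

Lemma lim_le0 u l r K : lim u l -> (forall n, r <= K * nm (u n - l)) -> r <= 0.
Proof.
by move=> ul H; apply: (lim_le0_2 (K' := 0) ul ul) => n; rewrite mul0r addr0.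
Qed.

Lemma lim_bound u l v k K : lim u l ->
  (forall n, nm (v n - k) <= K * nm (u n - l)) -> lim v k.
Proof.
move=> ul H eps e0.
have K0 : 0 < `|K| + 1 by rewrite ltr_wpDl.
have [N hN] := ul _ (divr_gt0 e0 K0); exists N => m /hN hm.
apply: le_lt_trans (H m) _.
apply: (@le_lt_trans _ _ ((`|K| + 1) * nm (u m - l))).
  rewrite ler_wpM2r ?nm_ge0 //; apply: le_trans (ler_norm _) _; lra.
by rewrite mulrC -ltr_pdivlMr.
Qed.

Lemma limD u l v k : lim u l -> lim v k -> lim (fun n => u n + v n) (l + k).
Proof.
move=> ul vk eps e0; have e2 : 0 < eps / 2 by lra.
have [N hN] := ul _ e2; have [M hM] := vk _ e2; exists (maxn N M) => m.
rewrite geq_max => /andP[/hN h1 /hM h2].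
have -> : u m + v m - (l + k) = (u m - l) + (v m - k) by rewrite opprD addrACA.
by apply: le_lt_trans (nmD _ _) _; lra.
Qed.

Lemma limZ a u l : lim u l -> lim (fun n => a *: u n) (a *: l).
Proof.
move=> ul; apply: (lim_bound (K := complex.Re `|a|) ul) => n.
by rewrite -scalerBr nmZC.
Qed.

Lemma lim_cst l : lim (fun=> l) l.
Proof. by move=> eps e0; exists 0%N => m _; rewrite subrr nm0. Qed.

Lemma lim_unique u l k : lim u l -> lim u k -> l = k.
Proof.
move=> ul uk; apply/eqP; rewrite -subr_eq0; apply/eqP/nm_eq0.
have vlim := limD (limZ (-1) ul) uk.
apply/eqP; rewrite eq_le nm_ge0 andbT.
apply: (@lim_le0 _ _ _ 1 vlim) => n; rewrite mul1r !scaleN1r addNr sub0r nmN.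
by rewrite (addrC (- l)) nmBC.
Qed.

Lemma lim_rip u l y r : lim u l -> (forall n, rip (u n) y = r) -> rip l y = r.
Proof.
move=> ul H; apply/eqP; rewrite -subr_eq0 -normr_le0.
apply: (lim_le0 (K := nm y) ul) => n.
rewrite -(H n) distrC -ripNl -ripDl mulrC; exact: rip_CS.
Qed.

Lemma lim_ip0 u l y : lim u l -> (forall n, ip (u n) y = 0) -> ip l y = 0.
Proof.
move=> ul H; apply/eqP; rewrite eq_complex; apply/andP; split; apply/eqP.
  by apply: (lim_rip ul) => n; rewrite /re_ip H.
apply: oppr_inj; rewrite -ripi oppr0.
by apply: (lim_rip (limZ 'i%C ul)) => n; rewrite /re_ip ipZl H mulr0.
Qed.

(** * Projection onto a closed real subspace *)

Section Projection.
Hypothesis complete : hcomplete ip.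
Variable L : V -> Prop.
Hypotheses (L0 : L 0) (LD : forall (a : R) x y, L x -> L y -> L (rC a *: x + y)).
Hypothesis Lcl : forall u l, (forall n, L (u n)) -> lim u l -> L l.

(** A sequence in [L] minimizing the distance to [z] is Cauchy. Since [L] is stable under real
    scalars, minimality gives orthogonality for the real part of the product. *)
Lemma projection z : exists2 l, L l & forall x, L x -> rip (z - l) x = 0.
Proof.
pose q x := rip x x.
pose E : set R := [set r | exists2 x, L x & r = q (z - x)]%classic.
have E0 : has_inf E.
  split; first by exists (q (z - 0)); exists 0.
  by exists 0 => _ [x _ ->]; exact: rip_ge0.
pose d := inf E.
have dle x : L x -> d <= q (z - x).
  by move=> Lx; apply: (ge_inf E0.2); exists x.
have /choice[l lP] (n : nat) : exists x, L x /\ q (z - x) < d + n.+1%:R^-1.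
  have n0 : 0 < n.+1%:R^-1 :> R by rewrite invr_gt0 ltr0n.
  by have [_ [x Lx ->] lt_x] := inf_adherent n0 E0; exists x.
have cau : hcauchy ip l.
  move=> eps e0.
  have e1 : 0 < eps ^+ 2 / 4 by rewrite divr_gt0 ?exprn_gt0.
  have [N hN] := natSinv_lt e1; exists N => m k /hN hm /hN hk.
  apply: nm_lt; first exact: ltW.
  have := lP m; have := lP k => -[Lk qk] [Lm qm].
  (* The midpoint of [l m] and [l k] has squared distance at least [d] from [z], so the
     parallelogram law bounds |l m - l k|^2 by 2/(m+1) + 2/(k+1). *)
  have Lmid : L (rC (2^-1) *: l m + (rC (2^-1) *: l k + 0)) by do 2!apply: LD => //.
  move: (dle _ Lmid) qk qm hm hk; rewrite /q addr0 !opprD !ripE.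
  rewrite (ripC (l m) z) (ripC (l k) z) (ripC (l k) (l m)).
  move: (rip z z) (rip z (l m)) (rip z (l k)) (rip (l m) (l m)) (rip (l m) (l k)).
  move: (rip (l k) (l k)) (k.+1%:R^-1) (m.+1%:R^-1) (eps ^+ 2) => *.
  by clearbody d; lra.
have [l' ll'] := complete cau; exists l'; first exact: (Lcl (fun n => (lP n).1) ll').
move=> x Lx.
have small n : rip (z - l n) x ^+ 2 <= q x * n.+1%:R^-1.
  have [Ln qn] := lP n.
  have [->|/eqP x0] := eqVneq x 0; first by rewrite /q /re_ip !ip0r /= expr0n mul0r.
  have qx := rip_gt0 x0.
  (* Moving from [l n] along [x] by the optimal multiple lowers the squared distance by <z - l n,
     x>^2 / q x; as it stays at least [d], this gain is below 1/(n+1). *)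
  move: qn (dle _ (LD (rip (z - l n) x / q x) Lx Ln)).
  have -> t : z - (rC t *: x + l n) = z - l n - rC t *: x by rewrite opprD addrCA addrC.
  move: (z - l n) => w; rewrite /q !ripE (ripC x w).
  have : rip w x / rip x x * rip x x = rip w x by rewrite divfK // gt_eqF.
  move: (rip w x / rip x x) n.+1%:R^-1 => t f tE; rewrite tE => lt_d d_le.
  have : t * rip w x < f by lra.
  by rewrite -(ltr_pM2r qx) mulrAC tE -expr2 mulrC => /ltW.
apply/eqP; rewrite -normr_le0 leNgt; apply/negP; set r := rip (z - l') x => r0.
have r2 : 0 < `|r| / 2 by lra.
have K0 : 0 < nm x + 1 by have := nm_ge0 x; lra.
have [N hN] := ll' _ (divr_gt0 r2 K0).
have Q0 : 0 < q x + 1 by have := rip_ge0 x; rewrite -/(q x); lra.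
have [M hM] := natSinv_lt (divr_gt0 (exprn_gt0 2 r2) Q0).
pose n := maxn N M.
have {}hN : nm (l n - l') < `|r| / 2 / (nm x + 1) by apply: hN; rewrite leq_maxl.
have {}hM := hM n (leq_maxr _ _).
have h1 : `|rip (l n - l') x| < `|r| / 2.
  apply: le_lt_trans (rip_CS _ _) _.
  move: hN; rewrite ltr_pdivlMr // => hN; apply: le_lt_trans hN.
  by rewrite ler_wpM2l ?nm_ge0 // lerDl.
have h2 : `|r| / 2 < `|rip (z - l n) x|.
  have -> : rip (z - l n) x = r - rip (l n - l') x.
    by rewrite /r -ripNl -ripDl opprB addrA subrK.
  have := lerB_dist r (rip (l n - l') x); lra.
have h3 : (`|r| / 2) ^+ 2 < rip (z - l n) x ^+ 2.
  by rewrite -(real_normK (num_real (rip _ _))) ltr_pXn2r ?nnegrE ?normr_ge0 ?(ltW r2).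
move: hM; rewrite ltr_pdivlMr // => hM.
have := small n; have : 0 < n.+1%:R^-1 :> R by rewrite invr_gt0 ltr0n.
move: hM; move: n.+1%:R^-1 => f hM f0; apply/negP; rewrite -ltNge.
by apply: lt_trans h3; apply: lt_trans hM; rewrite mulrDr mulr1 mulrC ltrDl.
Qed.

End Projection.

End InnerProduct.

(** * Bounded operators, Riesz representation and adjoints *)

Section Operators.
Variables (R : realType) (V : lmodType R[i]) (ip : V -> V -> R[i]).
Hypothesis ipP : inner_product_axioms ip.

Local Notation nm := (hnorm ip).
Local Notation rip := (re_ip ip).
Local Notation lim := (lim ip).
Local Notation rC a := (a%:C%C).

Lemma lim_rip2 u l v k y z : lim u l -> lim v k ->
  (forall n, rip (u n) y = rip (v n) z) -> rip l y = rip k z.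
Proof.
move=> ul vk H; apply/eqP; rewrite -subr_eq0 -normr_le0.
apply: (lim_le0_2 (K := nm y) (K' := nm z) ul vk) => n.
have -> : rip l y - rip k z = rip (v n - k) z - rip (u n - l) y.
  by rewrite !(ripE ipP) H; ring.
apply: le_trans (ler_normB _ _) _; rewrite addrC.
by apply: lerD; rewrite mulrC; exact: rip_CS.
Qed.

Lemma lim_ip2 u l v k y z : lim u l -> lim v k ->
  (forall n, ip (u n) y = ip (v n) z) -> ip l y = ip k z.
Proof.
move=> ul vk H; apply/eqP; rewrite eq_complex; apply/andP; split; apply/eqP.
  by apply: (lim_rip2 ul vk) => n; rewrite /re_ip H.
apply: oppr_inj; rewrite -!(ripi ipP).
by apply: (lim_rip2 (limZ ipP 'i%C ul) (limZ ipP 'i%C vk)) => n;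
  rewrite /re_ip !(ipZl ipP) H.
Qed.

Lemma lim_ipC u l v k y z : lim u l -> lim v k ->
  (forall n, ip (u n) y = ip z (v n)) -> ip l y = ip z k.
Proof.
move=> ul vk H; apply/eqP; rewrite eq_complex; apply/andP; split; apply/eqP.
  rewrite -!/(re_ip ip _ _) (ripC ipP z).
  by apply: (lim_rip2 ul vk) => n; rewrite (ripC ipP _ z) /re_ip H.
have ImE x x' : complex.Im (ip x x') = rip ('i%C *: x') x.
  by rewrite (ripi ipP) (ipC ipP x' x); case: (ip x' x).
have ImE' x x' : complex.Im (ip x x') = rip ('i%C *: x) (- x').
  by rewrite (ripNr ipP) (ripi ipP) opprK.
rewrite (ImE z k) (ImE' l y); apply: (lim_rip2 (limZ ipP 'i%C ul) (limZ ipP 'i%C vk)) => n.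
by rewrite -(ImE z (v n)) -(ImE' (u n) y) H.
Qed.

Lemma ip_ext x y : (forall z, ip x z = ip y z) -> x = y.
Proof.
move=> H; apply/eqP; rewrite -subr_eq0; apply/eqP/(rip_eq0 ipP).
by rewrite /re_ip (ipBl ipP) H subrr.
Qed.

Lemma adjointC T S : is_adjoint ip T S -> is_adjoint ip S T.
Proof. by move=> H x y; rewrite (ipC ipP) -H -(ipC ipP). Qed.

Lemma adjointP T S : is_adjoint ip T S ->
  forall a x y, T (a *: x + y) = a *: T x + T y.
Proof.
by move=> H a x y; apply: ip_ext => z; rewrite H !(ipDl ipP, ipZl ipP) !H.
Qed.

Section LinearOp.
Variable T : V -> V.
Hypothesis Tlin : forall a x y, T (a *: x + y) = a *: T x + T y.

Lemma lopD x y : T (x + y) = T x + T y.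
Proof. by have := Tlin 1 x y; rewrite !scale1r. Qed.

Lemma lop0 : T 0 = 0.
Proof. by apply: (@addrI _ (T 0)); rewrite -lopD !addr0. Qed.

Lemma lopZ a x : T (a *: x) = a *: T x.
Proof. by have := Tlin a x 0; rewrite lop0 !addr0. Qed.

Lemma lopN x : T (- x) = - T x.
Proof. by rewrite -scaleN1r lopZ scaleN1r. Qed.

Lemma lopB x y : T (x - y) = T x - T y.
Proof. by rewrite lopD lopN. Qed.

End LinearOp.

(** If f z <> 0, subtracting from [z] its projection onto the kernel of [f] leaves [u] orthogonal to
    that kernel, first for real parts, then for [ip] because the kernel is stable under
    multiplication by i. Every x - (f x / f z) u lies in the kernel, which gives the representing
    multiple of [u]. *)
Lemma riesz (f : V -> R[i]) (K : R) : hcomplete ip ->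
  (forall a x y, f (a *: x + y) = a * f x + f y) ->
  (forall x, complex.Re `|f x| <= K * nm x) ->
  exists s, forall x, f x = ip x s.
Proof.
move=> complete flin fbd.
have f0 : f 0 = 0.
  apply: (@addrI _ (f 0)); have := flin 1 0 0.
  by rewrite scale1r mul1r !addr0 => <-.
have [[z fz]|f_eq0] := pselect (exists z, f z <> 0); last first.
  exists 0 => x; rewrite (ip0r ipP).
  by apply: contrapT => fx; apply: f_eq0; exists x.
have fcl u l : (forall n, f (u n) = 0) -> lim u l -> f l = 0.
  move=> fu ul; apply: Re_norm_le0.
  have E n : complex.Re `|f l| = complex.Re `|f (u n - l)|.
    by have := flin (-1) l (u n); rewrite fu addr0 mulN1r scaleN1r addrC => ->; rewrite normrN.
  by apply: (lim_le0 (K := K) ul) => n; rewrite (E n); have := fbd (u n - l).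
have [] := @projection _ _ _ ipP complete (fun x => f x = 0) f0 _ fcl z.
  by move=> a x y fx fy; rewrite flin fx fy mulr0 addr0.
move=> l fl orth; set u := z - l.
have fu : f u = f z.
  by have := flin (-1) l z; rewrite fl mulr0 add0r scaleN1r addrC.
have u0 : u <> 0 by move=> u0; apply: fz; rewrite -fu u0 f0.
have uu := rip_gt0 ipP u0.
have perp x : f x = 0 -> ip x u = 0.
  move=> fx; apply/eqP; rewrite eq_complex; apply/andP; split; apply/eqP.
    by have := orth x fx; rewrite (ripC ipP).
  apply: oppr_inj; rewrite -(ripi ipP) (ripC ipP) orth ?oppr0 //.
  by rewrite -[_ *: x]addr0 flin fx f0 mulr0 addr0.
exists ((f z / ip u u)^* *: u) => x.
rewrite (ipZr ipP) conjCK.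
have := perp (- (f x / f z) *: u + x); rewrite flin fu mulNr divfK; last exact/eqP.
rewrite addNr => /(_ erefl); rewrite (ipDl ipP) (ipZl ipP) => /eqP.
rewrite mulNr addrC subr_eq0 => /eqP ->.
have : ip u u != 0 by rewrite (ipxxE ipP) eq_complex /= eqxx andbT gt_eqF.
by have /eqP := fz; move=> h1 h2; field; apply/andP.
Qed.

Lemma ip_CS x y : complex.Re `|ip x y| <= nm x * nm y.
Proof.
have [->|xy0] := eqVneq (ip x y) 0.
  by rewrite normr0 /= mulr_ge0 ?nm_ge0.
have xyn : `|ip x y| != 0 by rewrite normr_eq0.
(* A unimodular factor that makes the product real and nonnegative reduces the claim to the real
   Cauchy-Schwarz inequality. *)
pose c := `|ip x y| / ip x y.
have c1 : `|c| = 1 by rewrite normrM normfV normr_id divff.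
have := rip_CS ipP (c *: x) y.
rewrite (nmZC ipP) c1 /= mul1r; apply: le_trans.
by rewrite {1}/re_ip (ipZl ipP) /c divfK // ler_norm.
Qed.

Lemma adjoint_exists T : hcomplete ip -> bounded_linear ip T ->
  exists S, is_adjoint ip T S /\ bounded_linear ip S.
Proof.
move=> complete [Tlin [M Tbd]].
have /choice[S TS] y : exists s, forall x, ip (T x) y = ip x s.
  apply: (riesz (K := M * nm y) complete) => [a u v|x].
    by rewrite Tlin (ipDl ipP) (ipZl ipP).
  apply: le_trans (ip_CS _ _) _.
  by rewrite mulrAC ler_wpM2r ?nm_ge0.
exists S; have adj : is_adjoint ip T S by move=> x y.
split=> //; split; first exact: (adjointP (adjointC adj)).
exists M => x.
(* [M] bounds [S] as well: |S x|^2 = <T (S x), x> <= M |S x| |x|, to be divided by |S x|. If S x =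
   0, the bound on [T] at [x] shows 0 <= M |x|. *)
have [Sx0|/eqP Sx0] := eqVneq (S x) 0.
  rewrite Sx0 (nm0 ipP); have := Tbd x; apply: le_trans; exact: nm_ge0.
have Sx1 : 0 < nm (S x).
  by rewrite lt_def nm_ge0 andbT; apply/eqP => /(nm_eq0 ipP).
rewrite -(ler_pM2r Sx1) -expr2 (nm2 ipP) /re_ip -TS.
apply: le_trans (ler_norm _) _; apply: le_trans (rip_CS ipP _ _) _.
by rewrite mulrAC ler_wpM2r ?nm_ge0.
Qed.

End Operators.

(* The iteration w_(n+1) = (t + w_n^2) / 2 for 1 - sqrt (1 - t), at t = 1; since its
   increments are polynomials in t with nonnegative coefficients, they bound those
   of the operator iteration for any contraction t. *)
Fixpoint sqrt_majorant (R : realType) n : R :=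
  if n is n.+1 then (1 + sqrt_majorant R n ^+ 2) / 2 else 0.

(** The gap b = 1 - w_n evolves by b - b^2/2, under which the bound 2/k passes to 2/(k+1). Hence the
    majorant tends to 1, with an explicit rate. *)
Lemma sqrt_majorant_bounds (R : realType) n :
  0 <= sqrt_majorant R n <= 1 /\ 1 - sqrt_majorant R n <= 2 * n.+1%:R^-1.
Proof.
elim: n => [|n [/andP[a0 a1] IH]] /=.
  by rewrite lexx ler01 invr1; split => //; lra.
move: a0 a1 IH; move: (sqrt_majorant R n) => a a0 a1.
have k0 : 0 < n.+1%:R :> R by rewrite ltr0n.
rewrite -(natr1 n.+1); move: n.+1%:R k0 => k k0.
rewrite ler_pdivlMr // => IH; split; first by apply/andP; split; nra.
rewrite ler_pdivlMr; last lra.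
nra.
Qed.

(** * Absolute value of a bounded self-adjoint operator *)

Section AbsoluteValue.
Variables (R : realType) (V : lmodType R[i]) (ip : V -> V -> R[i]).
Hypothesis ipP : inner_product_axioms ip.
Hypothesis complete : hcomplete ip.

Local Notation nm := (hnorm ip).
Local Notation rip := (re_ip ip).
Local Notation lim := (lim ip).
Local Notation rC a := (a%:C%C).
Local Notation sym A := (is_adjoint ip A A).

Variables (X : V -> V) (M : R).
Hypotheses (Xsym : sym X) (Xbd : forall x, nm (X x) <= M * nm x).

(* As m > |X|, E is a contraction; the iterates converge to some W with
   W = (E + W^2) / 2, so (1 - W)^2 = 1 - E and m (1 - W) squares to X^2. *)
Let m := `|M| + 1.
Let m0 : 0 < m. Proof. by rewrite ltr_wpDl. Qed.
Let E x := x - rC (m ^- 2) *: X (X x).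
Let a := sqrt_majorant R.

Fixpoint sqrt_iter n : V -> V :=
  if n is n.+1 then fun x => rC (2^-1) *: (E x + sqrt_iter n (sqrt_iter n x))
  else fun=> 0.
Local Notation W := sqrt_iter.

Let conj_real (r : R) : (rC r)^* = rC r.
Proof. by rewrite conjE conjc_real. Qed.

Let Esym : sym E.
Proof.
move=> x y; rewrite /E (ipBl ipP) (ipBr ipP) (ipZl ipP) (ipZr ipP) conj_real.
by rewrite !Xsym.
Qed.

Let Wsym n : sym (W n).
Proof.
elim: n => [|n IH] x y /=; first by rewrite (ip0l ipP) (ip0r ipP).
rewrite (ipZl ipP) (ipZr ipP) conj_real (ipDl ipP) (ipDr ipP).
by rewrite Esym !IH.
Qed.

Let Wlin n := adjointP ipP (Wsym n).

(** |E x|^2 = |x|^2 - 2 m^-2 |X x|^2 + m^-4 |X X x|^2, and the last term is at most m^-2 |X x|^2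
    because |X| <= m. *)
Let E_contract x : nm (E x) <= nm x.
Proof.
apply: (nm_le ipP); first exact: nm_ge0.
rewrite (nm2 ipP) /E !(ripE ipP).
have XX : rip (X (X x)) x = nm (X x) ^+ 2 by rewrite (nm2 ipP) /re_ip Xsym.
rewrite (ripC ipP x (X (X x))) XX -(nm2 ipP (X (X x))).
have le1 : nm (X (X x)) ^+ 2 <= m ^+ 2 * nm (X x) ^+ 2.
  rewrite -exprMn ler_pXn2r ?nnegrE ?mulr_ge0 ?nm_ge0 ?(ltW m0) //.
  apply: le_trans (Xbd _) _; rewrite ler_wpM2r ?nm_ge0 //.
  by apply: le_trans (ler_norm _) _; rewrite lerDl.
have n0 : 0 < m ^- 2 by rewrite invr_gt0 exprn_gt0.
have le2 : m ^- 2 * nm (X (X x)) ^+ 2 <= nm (X x) ^+ 2.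
  by rewrite mulrC ler_pdivrMr ?exprn_gt0 // mulrC.
have := sqr_ge0 (nm (X x)).
move: le2 n0; move: (m ^- 2) (nm (X (X x)) ^+ 2) (nm (X x) ^+ 2) (rip x x) => *; nra.
Qed.

Let aS n : a n.+1 = (1 + a n ^+ 2) / 2. Proof. by []. Qed.
Let a_0 : a 0 = 0. Proof. by []. Qed.
Let a_ge0 n : 0 <= a n. Proof. by have [/andP[]] := sqrt_majorant_bounds R n. Qed.
Let a_le1 n : a n <= 1. Proof. by have [/andP[]] := sqrt_majorant_bounds R n. Qed.

Let W_le n x : nm (W n x) <= a n * nm x.
Proof.
elim: n x => [|n IH] x; first by rewrite /= (nm0 ipP) mul0r.
rewrite aS [W _]/= (nmZ ipP) ger0_norm ?invr_ge0 ?ler0n //.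
have h1 := nmD ipP (E x) (W n (W n x)).
have h2 := IH (W n x); have h3 := E_contract x.
have := ler_wpM2l (a_ge0 n) (IH x); lra.
Qed.

Let D_le n x : nm (W n.+1 x - W n x) <= (a n.+1 - a n) * nm x.
Proof.
elim: n x => [|n IH] x.
  rewrite /= !subr0 addr0 (nmZ ipP) ger0_norm ?invr_ge0 ?ler0n //.
  have := E_contract x; rewrite aS a_0 expr0n /=; lra.
(* With P, P' two successive iterates, P'^2 - P^2 = P' (P' - P) + (P' - P) P; the scalar majorants
   split in the same way. *)
have -> : W n.+2 x - W n.+1 x =
    rC (2^-1) *: (W n.+1 (W n.+1 x - W n x) + (W n.+1 (W n x) - W n (W n x))).
  rewrite (lopB (Wlin n.+1)) addrA subrK.
  by rewrite [W n.+2 x]/= [W n.+1 x in X in _ - X]/= -scalerBr opprD addrACA subrr add0r.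
rewrite (nmZ ipP) ger0_norm ?invr_ge0 ?ler0n //.
have h1 := nmD ipP (W n.+1 (W n.+1 x - W n x)) (W n.+1 (W n x) - W n (W n x)).
have h2 := W_le n.+1 (W n.+1 x - W n x).
have h3 := ler_wpM2l (a_ge0 n.+1) (IH x).
have d0 : 0 <= a n.+1 - a n.
  by have := sqr_ge0 (1 - a n); rewrite aS sqrrB; lra.
have h4 := IH (W n x).
have h5 := ler_wpM2l d0 (W_le n x).
have -> : a n.+2 - a n.+1 = 2^-1 * (a n.+1 ^+ 2 - a n ^+ 2).
  by rewrite (aS n.+1) (aS n); field.
lra.
Qed.

Let W_tel n k x : nm (W (n + k) x - W n x) <= (a (n + k) - a n) * nm x.
Proof.
elim: k => [|k IH]; first by rewrite addn0 !subrr (nm0 ipP) mul0r.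
rewrite addnS.
have := nmD ipP (W (n + k).+1 x - W (n + k) x) (W (n + k) x - W n x).
rewrite addrA subrK; have := D_le (n + k) x; lra.
Qed.

Let W_cauchy x : hcauchy ip (W^~ x).
Proof.
move=> eps e0.
have K0 : 0 < 4 * (nm x + 1) by have := nm_ge0 ip x; lra.
have [N hN] := natSinv_lt (divr_gt0 e0 K0); exists N => p q Np Nq.
have tail k : (N <= k)%N -> nm (W k x - W N x) < eps / 2.
  move=> /subnKC <-; apply: le_lt_trans (W_tel _ _ _) _.
  have := hN N (leqnn N); rewrite ltr_pdivlMr // => h.
  have [_ b] := sqrt_majorant_bounds R N.
  have h1 := a_le1 (N + (k - N)).
  have h2 : a (N + (k - N)) - a N <= 2 * N.+1%:R^-1 by apply: le_trans b; apply: lerB.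
  have h3 := ler_wpM2r (nm_ge0 ip x) h2.
  have h4 : 0 < N.+1%:R^-1 :> R by rewrite invr_gt0 ltr0n.
  apply: le_lt_trans h3 _; move: h h4; move: (N.+1%:R^-1) => f; lra.
have := tail p Np; have := tail q Nq; rewrite [nm (_ q _ - _)]nmBC //.
have := nmD ipP (W p x - W N x) (W N x - W q x); rewrite addrA subrK; lra.
Qed.

(** Q = m (1 - L), where L is the strong limit of polynomials in X^2. So Q inherits commutation with
    whatever commutes with X^2, in particular with an operator that anticommutes with X, and it
    preserves the orthogonal complement of any set stable under X. *)
Lemma abs_op : exists Q, [/\ sym Q, forall x, Q (Q x) = X (X x),
  (forall B, sym B -> (forall x, X (X (B x)) = B (X (X x))) ->
     forall x, Q (B x) = B (Q x)) &
  (forall G : V -> Prop, (forall g, G g -> G (X g)) ->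
     forall x, (forall g, G g -> ip x g = 0) -> forall g, G g -> ip (Q x) g = 0)].
Proof.
have /choice[L WL] x : exists l, lim (W^~ x) l by exact: complete (@W_cauchy x).
have Lsym : sym L.
  by move=> x y; apply: (lim_ipC ipP (WL x) (WL y)) => n; exact: Wsym.
have Lfix x : L x = rC (2^-1) *: (E x + L (L x)).
  have shift : lim (fun n => W n.+1 x) (L x).
    by move=> eps /(WL x)[N hN]; exists N => k Nk; apply/hN/leqW.
  apply: (lim_unique ipP shift); apply: (limZ ipP); apply: (limD ipP).
    exact: lim_cst.
  (* W_n (W_n x) tends to L (L x): W_n (L x) does, and the difference W_n (W_n x - L x) tends to 0
     since each W_n is a contraction. *)
  have := limD ipP (_ : lim (fun n => W n (W n x - L x)) 0) (WL (L x)).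
  rewrite add0r => h.
  suff: lim (fun n => W n (W n x - L x) + W n (L x)) (L (L x)).
    by congr (lim _ _); apply/funext => n; rewrite (lopB (Wlin n)) subrK.
  apply: h; apply: (lim_bound (K := 1) (WL x)) => n; rewrite subr0.
  apply: le_trans (W_le _ _) _; rewrite ler_wpM2r ?nm_ge0 ?a_le1 //.
have Llin := adjointP ipP Lsym.
exists (fun x => rC m *: (x - L x)); split.
- move=> x y; rewrite (ipZl ipP) (ipZr ipP) conj_real.
  by rewrite (ipBl ipP) (ipBr ipP) Lsym.
- move=> x.
  (* The fixed point equation read as L^2 = 2 L - E, whence (1 - L)^2 = 1 - E = m^-2 X^2. *)
  have LL : L (L x) = L x *+ 2 - E x.
    rewrite {2}(Lfix x) -scaler_nat scalerA -[2%:R](rmorph_nat (real_complex R)).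
    by rewrite -rmorphM /= divff ?pnatr_eq0 // scale1r addrAC subrr add0r.
  rewrite (lopZ Llin) -scalerBr (lopB Llin) LL mulr2n.
  have -> : x - L x - (L x - (L x + L x - E x)) = x - E x.
    by rewrite [- (L x - _)]opprB [_ + _ - _ - _]addrAC addrK addrA subrK.
  have mm : rC m * (rC m * rC (m ^- 2)) = 1.
    by rewrite -!(rmorphM (real_complex R)) mulrA -expr2 divff ?expf_eq0 ?gt_eqF.
  by rewrite /E opprB addrCA subrr addr0 !scalerA -?mulrA mm scale1r.
- move=> B Bsym BX x; have Blin := adjointP ipP Bsym.
  have WB n y : W n (B y) = B (W n y).
    elim: n y => [|n IH] y /=; first by rewrite (lop0 Blin).
    by rewrite (lopZ Blin) (lopD Blin) -!IH /E BX (lopB Blin) (lopZ Blin).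
  suff -> : L (B x) = B (L x) by rewrite (lopZ Blin) (lopB Blin).
  apply: (ip_ext ipP) => z; rewrite Bsym.
  by apply: (lim_ip2 ipP (WL _) (WL x)) => n; rewrite WB Bsym.
move=> G GX x xG g Gg.
have perpE y : (forall g, G g -> ip y g = 0) -> forall g, G g -> ip (E y) g = 0.
  move=> yG h Gh; rewrite (ipBl ipP) (ipZl ipP) yG // 2!Xsym yG ?mulr0 ?subr0 //.
  exact/GX/GX.
have perpW n : forall y, (forall g, G g -> ip y g = 0) -> forall g, G g -> ip (W n y) g = 0.
  elim: n => [|n IH] y yG h Gh /=; first by rewrite (ip0l ipP).
  by rewrite (ipZl ipP) (ipDl ipP) perpE // (IH (W n y)) ?addr0 ?mulr0 //; exact: IH.
rewrite (ipZl ipP) (ipBl ipP) xG // (lim_ip0 ipP (WL x)) ?subr0 ?mulr0 // => n.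
exact: perpW.
Qed.

End AbsoluteValue.

(** * A conjugation commuting with a family of self-adjoint operators *)

Section CommutingConjugation.
Variables (R : realType) (V : lmodType R[i]) (ip : V -> V -> R[i]).
Hypothesis ipP : inner_product_axioms ip.
Hypothesis complete : hcomplete ip.

Local Notation nm := (hnorm ip).
Local Notation rip := (re_ip ip).
Local Notation lim := (lim ip).
Local Notation rC a := (a%:C%C).
Local Notation Im := complex.Im.

Variables (I : Type) (A : I -> V -> V).
Hypothesis Asym : forall i, is_adjoint ip (A i) (A i).

Definition word (w : seq I) (x : V) : V := foldr A x w.

Lemma word_adjoint w : is_adjoint ip (word w) (word (rev w)).
Proof.
elim: w => [|i w IH] x y //=.
by rewrite Asym IH rev_cons /word foldr_rcons.
Qed.

Let wlin w := adjointP ipP (word_adjoint w).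

Definition real_on (G : set V) :=
  forall w g h, G g -> G h -> Im (ip (word w g) h) = 0.

(** The one ingredient that depends on the particular operators: a vector by which a real set that
    does not yet span can be enlarged. *)
Hypothesis real_vector : forall G : set V, (forall i g, G g -> G (A i g)) ->
  forall u, u <> 0 -> (forall g, G g -> ip u g = 0) ->
  exists e, [/\ e <> 0, forall g, G g -> ip e g = 0 &
                forall w, Im (ip (word w e) e) = 0].

Let Im_sym x y : Im (ip x y) = 0 -> Im (ip y x) = 0.
Proof. by rewrite (ipC ipP x y); case: (ip x y) => a b /= ->; rewrite oppr0. Qed.

Let lim_Im u l y : lim u l -> (forall n, Im (ip (u n) y) = 0) -> Im (ip l y) = 0.
Proof.
move=> ul H; apply: oppr_inj; rewrite -(ripi ipP) oppr0.
by apply: (lim_rip ipP (limZ ipP 'i%C ul)) => n; rewrite (ripi ipP) H oppr0.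
Qed.

Lemma commuting_conjugation :
  exists C, conjugation ip C /\ forall i x, C (A i x) = A i (C x).
Proof.
(* Reality involves two vectors at a time, and two members of a union of a chain already lie in a
   common set of the chain; Zorn's lemma applies. *)
have [F FP Ftot|G [Greal Gmax]] := @Zorn_bigcup _ real_on.
  move=> w g h [B FB Bg] [B' FB' B'h].
  have [BB'|B'B] := Ftot _ _ FB FB'.
    by apply: (FP _ FB') => //; exact: BB'.
  by apply: (FP _ FB) => //; exact: B'B.
(* Maximality as a membership test: if [x] is real against [G] and against itself, adding [x] to [G]
   keeps it real, the remaining products <w g, x> being conjugates of <rev w x, g>. *)
have Gmem x : (forall w g, G g -> Im (ip (word w x) g) = 0) ->
    (forall w, Im (ip (word w x) x) = 0) -> G x.
  move=> xG xx; apply: contrapT => Gx.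
  apply: (Gmax (G `|` [set x])%classic).
    split; first by move=> y Gy; left.
    by move=> /(_ x (or_intror erefl)).
  move=> w g h [Gg|->] [Gh|->] //.
  - exact: Greal.
  - by rewrite word_adjoint; apply/Im_sym/xG.
  - exact: xG.
have G0 : G 0.
  by apply: Gmem => [w g|w]; rewrite (lop0 (wlin w)) (ip0l ipP).
have GD (a : R) x y : G x -> G y -> G (rC a *: x + y).
  move=> Gx Gy; apply: Gmem => [w g Gg|w]; rewrite wlin.
    by rewrite (ipDl ipP) (ipZl ipP) ImD ImZ !Greal // mulr0 addr0.
  rewrite !(ipDl ipP, ipZl ipP) !(ipDr ipP, ipZr ipP) conjE conjc_real.
  by rewrite !(ImD, ImZ) !Greal // !mulr0 !addr0 mulr0.
have Gcl u l : (forall n, G (u n)) -> lim u l -> G l.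
  move=> Gu ul.
  have lG w g : G g -> Im (ip (word w l) g) = 0.
    move=> Gg; rewrite word_adjoint.
    by apply: (lim_Im ul) => n; rewrite -word_adjoint Greal.
  apply: Gmem => // w; apply: Im_sym.
  by apply: (lim_Im ul) => n; apply: Im_sym; exact: lG.
have GA i g : G g -> G (A i g).
  have wA w x : word w (A i x) = word (rcons w i) x by rewrite /word foldr_rcons.
  move=> Gg; apply: Gmem => [w h Gh|w]; rewrite wA; first exact: Greal.
  by rewrite -Asym; apply: (Greal (i :: rcons w i)).
have GN x : G x -> G (- x).
  by move=> Gx; have := GD (-1) x 0 Gx G0; rewrite addr0 rmorphN rmorph1 scaleN1r.
have GDD x y : G x -> G y -> G (x + y).
  by move=> Gx Gy; have := GD 1 x y Gx Gy; rewrite rmorph1 scale1r.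
have Gip x y : G x -> G y -> ip x y = rC (rip x y).
  move=> Gx Gy; apply/eqP; rewrite eq_complex /= eqxx /=; apply/eqP.
  exact: (Greal [::]).
(* Since Re <-i z, g> = Im <z, g>, projecting z and -i z onto [G] matches the real and imaginary
   parts of <z, g>, so u = z - l - i k satisfies <u, g> = 0. If u <> 0, [real_vector] yields a
   nonzero [e] that passes the membership test yet is orthogonal to [G], hence to itself. *)
have decomp z : exists p : V * V, [/\ G p.1, G p.2 & z = p.1 + 'i%C *: p.2].
  have [l Gl lP] := projection ipP complete G0 GD Gcl z.
  have [k Gk kP] := projection ipP complete G0 GD Gcl (- 'i%C *: z).
  exists (l, k); split => //=; apply/eqP; rewrite -subr_eq0.
  set u := z - _; apply/eqP; apply: contrapT => u0.
  have uG g : G g -> ip u g = 0.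
    move=> Gg; have := lP g Gg; have := kP g Gg.
    rewrite /u /re_ip opprD addrA !(ipDl ipP) !(ipNl ipP) !(ipZl ipP).
    rewrite (Gip l g) // (Gip k g) //.
    case: (ip z g) => a b /= h1 h2; apply/eqP; rewrite eq_complex /=.
    by apply/andP; split; apply/eqP; lra.
  have [e [e0 eG eR]] := real_vector GA u0 uG.
  apply: e0; apply: (rip_eq0 ipP); rewrite /re_ip eG //.
  apply: Gmem => // w g Gg; rewrite word_adjoint eG //.
  by elim: (rev w) => [|i v IH] //=; exact: GA.
have /choice[D DP] := decomp.
have uniq l k l' k' : G l -> G k -> G l' -> G k' ->
    l + 'i%C *: k = l' + 'i%C *: k' -> l = l' /\ k = k'.
  move=> Gl Gk Gl' Gk' H.
  have H0 : (l - l') + 'i%C *: (k - k') = 0.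
    by rewrite scalerBr addrACA H -opprD subrr.
  have Gll := GDD _ _ Gl (GN _ Gl'); have Gkk := GDD _ _ Gk (GN _ Gk').
  (* In the real product with l - l', the term i (k - k') contributes nothing, since products within
     [G] are real. *)
  have ll : l - l' = 0.
    have := congr1 (fun v => rip v (l - l')) H0.
    rewrite (ripDl ipP) (ripi ipP) (Gip (k - k')) //= oppr0 addr0.
    by rewrite {2}/re_ip (ip0l ipP); exact: rip_eq0.
  move: H0; rewrite ll add0r => /(congr1 (fun v => - 'i%C *: v)).
  rewrite scaler0 scalerA mulNr -expr2 sqr_i opprK scale1r => kk.
  by split; apply/eqP; rewrite -subr_eq0 ?ll ?kk.
pose C z := (D z).1 - 'i%C *: (D z).2.
have CE l k : G l -> G k -> C (l + 'i%C *: k) = l - 'i%C *: k.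
  move=> Gl Gk; have [G1 G2 E] := DP (l + 'i%C *: k).
  by rewrite /C; have [<- <-] := uniq _ _ _ _ Gl Gk G1 G2 E.
exists C; split; [split|].
- move=> [a b] x y; have [Gl Gk ->] := DP x; have [Gl' Gk' ->] := DP y.
  move: (D x).1 (D x).2 (D y).1 (D y).2 Gl Gk Gl' Gk' => l k l' k' Gl Gk Gl' Gk'.
  have cE d : Complex a d = rC a + 'i%C * rC d by rewrite [LHS]complexE.
  (* The normal form l + i k of a complex combination, with real coefficients on each part. It
     serves both [C]'s argument and, with the signs of d, j and j' reversed, the conjugate
     combination on the right. *)
  have comb d (v j v' j' : V) : Complex a d *: (v + 'i%C *: j) + (v' + 'i%C *: j') =
      (rC a *: v + (rC (- d) *: j + v')) + 'i%C *: (rC d *: v + (rC a *: j + j')).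
    have -> : rC (- d) *: j = 'i%C *: (rC d *: ('i%C *: j)).
      by rewrite !scalerA mulrAC -expr2 sqr_i mulN1r rmorphN.
    rewrite cE scalerDr !scalerDl !scalerDr -!scalerA.
    rewrite ['i%C *: (rC a *: j)]scalerA [_ * rC a]mulrC -scalerA.
    by rewrite [LHS](AC (2*2*2) ((1*(4*5))*(2*(3*6)))).
  rewrite conjE /= comb !CE //; first 1 last.
  - by do ?apply: (GD).
  - by do ?apply: (GD).
  rewrite -!scalerN !comb // opprK.
  by rewrite !opprD rmorphN !scaleNr !scalerN.
(* The cross term of |l + i k|^2 and of |l - i k|^2 is a multiple of Im <k, l>, which vanishes on
   [G]. *)
- move=> x; have [Gl Gk ->] := DP x; rewrite CE //.
  congr Num.sqrt; rewrite -!/(re_ip ip _ _) !(ripE ipP) !(ripi ipP).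
  rewrite !(ripC ipP _ ('i%C *: _)) !(ripi ipP).
  have -> : Im (ip (D x).2 (D x).1) = 0 by exact: (Greal [::]).
  by rewrite !opprK oppr0.
- move=> x; have [Gl Gk xE] := DP x; rewrite {2}/C -scalerN CE //; last exact: GN.
  by rewrite scalerN opprK -xE.
move=> i x; have [Gl Gk ->] := DP x; have Alin := adjointP ipP (@Asym i).
by rewrite CE // (lopD Alin) (lopB Alin) (lopZ Alin) CE //; exact: GA.
Qed.

End CommutingConjugation.

(** * Two anticommuting self-adjoint operators *)

Section Anticommuting.
Variables (R : realType) (V : lmodType R[i]) (ip : V -> V -> R[i]).
Hypothesis ipP : inner_product_axioms ip.
Hypothesis complete : hcomplete ip.

Local Notation nm := (hnorm ip).
Local Notation rC a := (a%:C%C).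
Local Notation sym A := (is_adjoint ip A A).

Lemma anticommuting_conjugation (X Y : V -> V) (M : R) :
  sym X -> sym Y -> (forall x, nm (X x) <= M * nm x) ->
  (forall x, X (Y x) = - Y (X x)) ->
  exists C, [/\ conjugation ip C, forall x, C (X x) = X (C x) &
                forall x, C (Y x) = Y (C x)].
Proof.
move=> Xsym Ysym Xbd XY.
pose A (b : bool) := if b then X else Y.
have Asym b : is_adjoint ip (A b) (A b) by case: b.
suff [C [Cc CA]] : exists C, conjugation ip C /\ forall b x, C (A b x) = A b (C x).
  by exists C; split=> // x; [exact: (CA true)|exact: (CA false)].
apply: (commuting_conjugation ipP complete Asym) => G GA u u0 uG.
have [Q [Qsym QQ Qcomm Qperp]] := abs_op ipP complete Xsym Xbd.
have Xlin := adjointP ipP Xsym; have Ylin := adjointP ipP Ysym.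
have Qlin := adjointP ipP Qsym.
have QX := Qcomm X Xsym (fun=> erefl).
(* The two signs cancel, so Y commutes with X^2 and therefore with Q. *)
have QY : forall x, Q (Y x) = Y (Q x).
  by apply: Qcomm => // x; rewrite XY (lopN Xlin) XY opprK.
have XG x : (forall g, G g -> ip x g = 0) -> forall g, G g -> ip (X x) g = 0.
  by move=> xG g Gg; rewrite Xsym xG //; exact: (GA true).
have QG := Qperp G (GA true).
(* From X^2 = Q^2 and X Q = Q X, the vectors X u + Q u and X u - Q u satisfy X e = Q e and X e = - Q
   e. If both vanish then X u = 0, and [u] itself serves with s = 0. *)
have [e [s [e0 eG Xe]]] : exists e (s : R), [/\ e <> 0,
    forall g, G g -> ip e g = 0 & X e = rC s *: Q e].
  have [e1|e1] := pselect (X u + Q u = 0); last first.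
    exists (X u + Q u), 1; split => //.
      by move=> g Gg; rewrite (ipDl ipP) XG // QG // addr0.
    by rewrite rmorph1 scale1r (lopD Xlin) (lopD Qlin) QQ QX addrC.
  have [e2|e2] := pselect (X u - Q u = 0); last first.
    exists (X u - Q u), (-1); split => //.
      by move=> g Gg; rewrite (ipBl ipP) XG // QG // subr0.
    by rewrite rmorphN rmorph1 scaleN1r (lopB Xlin) (lopB Qlin) QQ QX opprB.
  exists u, 0; split => //; rewrite rmorph0 scale0r.
  have : X u *+ 2 = 0 by rewrite mulr2n -[LHS]addr0 -[X in _ + X](subrr (Q u)) addrACA e1 e2 addr0.
  rewrite -scaler_nat => /eqP; rewrite scaler_eq0 pnatr_eq0 /= => /eqP //.
exists e; split => // w.
have iter_lin (B : V -> V) : (forall a x y, B (a *: x + y) = a *: B x + B y) ->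
    forall n a x y, iter n B (a *: x + y) = a *: iter n B x + iter n B y.
  by move=> Blin; elim=> //= n IH a x y; rewrite IH Blin.
have iter_comm (B D : V -> V) n x : (forall y, B (D y) = D (B y)) ->
    B (iter n D x) = iter n D (B x).
  by move=> BD; elim: n => //= n IH; rewrite BD IH.
have XYn n x : X (iter n Y x) = rC ((-1) ^+ n) *: iter n Y (X x).
  elim: n => [|n IH]; first by rewrite expr0 rmorph1 scale1r.
  by rewrite iterS XY IH (lopZ Ylin) -scaleNr -rmorphN exprS mulN1r.
(* A new letter X commutes with Q^j, passes Y^k at the cost of (-1)^k and turns e into s Q e,
   raising j; a new letter Y raises k. *)
have [c [j [k ->]]] : exists (c : R) j k, word A w e = rC c *: iter j Q (iter k Y e).
  elim: w => [|b w [c [j [k /= ->]]]].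
    by exists 1, 0%N, 0%N; rewrite rmorph1 scale1r.
  case: b => /=.
    exists (c * ((-1) ^+ k * s)), j.+1, k.
    rewrite (lopZ Xlin) iter_comm // XYn Xe (lopZ (iter_lin _ Ylin k)).
    rewrite !(lopZ (iter_lin _ Qlin j)) -(iter_comm Q Y k e QY) -iterSr.
    by rewrite !scalerA -!(rmorphM (real_complex R)) mulrA.
  exists c, j, k.+1; rewrite (lopZ Ylin) iter_comm //.
rewrite (ipZl ipP) ImZ.
have iter_adj B n : sym B -> sym (iter n B).
  by move=> Bsym; elim: n => // n IH x y; rewrite iterS Bsym IH -iterSr.
(* Q^j Y^k is self-adjoint because Q and Y commute, so this product equals its own conjugate. *)
have : ip (iter j Q (iter k Y e)) e = ip e (iter j Q (iter k Y e)).
  rewrite iter_adj // iter_adj //; congr (ip e _).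
  by elim: j => //= j <-; rewrite (iter_comm Q Y k _ QY).
rewrite [RHS](ipC ipP); case: (ip _ _) => p q [] /= qE.
by have -> : q = 0 by [lra]; rewrite mulr0.
Qed.

End Anticommuting.

(** * Operators of degree at most two *)

Section Quadratic.
Variables (R : realType) (V : lmodType R[i]) (ip : V -> V -> R[i]).
Hypothesis ipP : inner_product_axioms ip.
Hypothesis complete : hcomplete ip.

Local Notation nm := (hnorm ip).
Local Notation iC := ('i%C : R[i]).

Lemma bounded_linear_comb (T S : V -> V) a b :
  bounded_linear ip T -> bounded_linear ip S ->
  bounded_linear ip (fun x => a *: T x + b *: S x).
Proof.
move=> [Tlin [M TM]] [Slin [N SN]]; split.
  by move=> c x y; rewrite Tlin Slin !scalerDr !scalerA ![_ * c]mulrC addrACA.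
exists (complex.Re `|a| * M + complex.Re `|b| * N) => x.
apply: le_trans (nmD ipP _ _) _; rewrite !(nmZC ipP) mulrDl -!mulrA.
by apply: lerD; apply: ler_wpM2l => //; exact: Re_norm_ge0.
Qed.

(** The same conjugation works: the adjoint of a T + b carries conjugated coefficients, which a
    conjugate-linear [C] conjugates back. *)
Lemma complex_symmetric_affine (T S : V -> V) a b :
  is_adjoint ip T S -> complex_symmetric ip T ->
  complex_symmetric ip (fun x => a *: T x + b *: x).
Proof.
move=> TS [C [Cc [S' [TS' TE]]]].
have SS' y : S' y = S y by apply: (ip_ext ipP) => x; apply/(can_inj conjCK);
  rewrite -!(ipC ipP) -TS -TS'.
exists C; split => //; exists (fun y => a^* *: S y + b^* *: y); split.
  move=> x y; rewrite (ipDl ipP) !(ipZl ipP) (ipDr ipP) !(ipZr ipP).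
  by rewrite !conjCK TS.
case: Cc => Clin _ CC x.
have C0 : C 0 = 0.
  by have := Clin (-1) 0 0; rewrite scaler0 addr0 rmorphN rmorph1 scaleN1r addNr.
have CZ c y : C (c *: y) = c^* *: C y by have := Clin c y 0; rewrite C0 !addr0.
by rewrite Clin CZ !conjCK CC TE SS'.
Qed.

(** With T = X + i Y and S = X - i Y, the sum X Y + Y X is a multiple of T^2 - S^2, which is 0
    because r is real. A conjugation commuting with X and Y turns X - i Y into X + i Y. *)
Lemma complex_symmetric_real_square (T S : V -> V) (r : R[i]) :
  bounded_linear ip T -> is_adjoint ip T S -> r^* = r ->
  (forall x, T (T x) = r *: x) -> complex_symmetric ip T.
Proof.
move=> Tbl TS rJ TT.
have Sbl : bounded_linear ip S.
  have [S' [TS' S'bl]] := adjoint_exists ipP complete Tbl.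
  suff -> : S = S' by [].
  apply/funext => y; apply: (ip_ext ipP) => x; apply/(can_inj conjCK).
  by rewrite -!(ipC ipP) -TS -TS'.
have ST := adjointC ipP TS.
have SS y : S (S y) = r *: y.
  by apply: (ip_ext ipP) => x; rewrite !ST TT (ipZl ipP) (ipZr ipP) rJ.
have Tlin := Tbl.1; have Slin := Sbl.1.
pose X x := 2^-1 *: T x + 2^-1 *: S x.
pose Y x := (iC / 2) *: S x + (- (iC / 2)) *: T x.
have h2 : (2^-1 : R[i])^* = 2^-1 by rewrite fmorphV rmorph_nat.
have hi : iC^* = - iC by rewrite conjE /=; apply/eqP; rewrite eq_complex /= oppr0 !eqxx.
have Xsym : is_adjoint ip X X.
  move=> x y; rewrite /X (ipDl ipP) (ipDr ipP) !(ipZl ipP) !(ipZr ipP) h2.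
  by rewrite TS ST addrC.
have Ysym : is_adjoint ip Y Y.
  move=> x y; rewrite /Y (ipDl ipP) (ipDr ipP) !(ipZl ipP) !(ipZr ipP).
  by rewrite rmorphN !rmorphM /= hi h2 TS ST !mulNr opprK addrC.
have [M XM] := (bounded_linear_comb 2^-1 2^-1 Tbl Sbl).2.
have XY x : X (Y x) = - Y (X x).
  rewrite /X /Y !(lopD Tlin) !(lopD Slin) !(lopZ Tlin) !(lopZ Slin) !TT !SS.
  rewrite !scalerDr !scalerA !(mulrN, mulNr) !scaleNr; move: (T (S x)) (S (T x)) => u v.
  by rewrite ![2^-1 * (_ / 2)]mulrC !addrA subrK addrK opprB.
have [C [Cc CX CY]] := anticommuting_conjugation ipP complete Xsym Ysym XM XY.
exists C; split => //; exists S; split => // x.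
case: Cc => Clin _ CC.
have ii : iC * (iC / 2) = - 2^-1 by rewrite mulrA -expr2 sqr_i mulN1r.
have hh : (2^-1 + 2^-1 : R[i]) = 1 by field.
have TE y : T y = iC *: Y y + X y.
  rewrite /X /Y scalerDr !scalerA mulrN ii opprK scaleNr.
  by rewrite addrC addrA addrK -scalerDl hh scale1r.
have SE y : S y = - iC *: Y y + X y.
  rewrite /X /Y scalerDr !scalerA mulrNN !mulNr ii opprK scaleNr.
  by rewrite addrA subrK -scalerDl hh scale1r.
by rewrite TE SE Clin CX CY !CC rmorphN /= hi opprK.
Qed.

Lemma degree2_quadratic T : bounded_linear ip T -> algebraic_degree_le T 2 ->
  exists t d, forall x, T (T x) = t *: T x + d *: x.
Proof.
move=> [Tlin _] [p [p0 [pT size_p]]].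
have : lead_coef p != 0 by rewrite lead_coef_eq0.
rewrite lead_coefE; move: pT; rewrite /annihilates /poly_op.
move: size_p p0; rewrite -size_poly_gt0.
(* A nonzero constant that annihilates T forces V = 0; a relation of degree one is evaluated at T x;
   one of degree two is divided by its leading coefficient. *)
case: (size p) => [|[|[|[|//]]]] //= _ _ pT p0.
- have V0 (x : V) : x = 0.
    have := pT x; rewrite big_ord1 => /eqP.
    by rewrite scaler_eq0 (negbTE p0) => /eqP.
  by exists 0, 0 => x; rewrite [LHS]V0 [RHS]V0.
- exists (- (p`_0 / p`_1)), 0 => x; rewrite scale0r addr0.
  have := pT (T x); rewrite !big_ord_recl big_ord0 /= /bump /= !addn0 addr0 => /eqP.
  rewrite addrC addr_eq0 => /eqP /(congr1 (fun v : V => (p`_1)^-1 *: v)).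
  by rewrite scalerA mulVf // scale1r scalerN scalerA mulrC scaleNr.
exists (- (p`_1 / p`_2)), (- (p`_0 / p`_2)) => x.
have := pT x; rewrite !big_ord_recl big_ord0 /= /bump /= !addn0 addr0 addrA => /eqP.
rewrite addrC addr_eq0 => /eqP /(congr1 (fun v : V => (p`_2)^-1 *: v)).
rewrite scalerA mulVf // scale1r scalerN scalerDr !scalerA ![_^-1 * _]mulrC.
by rewrite !scaleNr opprD addrC.
Qed.

Lemma complex_symmetric_quadratic T : bounded_linear ip T ->
  algebraic_degree_le T 2 -> complex_symmetric ip T.
Proof.
move=> Tbl /(degree2_quadratic Tbl)[t [d TT]].
have Tlin := Tbl.1.
(* Completing the square: (T - t/2)^2 = c. Scaling by the conjugate w of a square root of c makes
   the square w^2 c = |c|^2 real; if c = 0, w = 1 keeps the scaling invertible. *)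
pose c := d + (t / 2) ^+ 2.
have [w w0 wc] : exists2 w : R[i], w != 0 & (w ^+ 2 * c)^* = w ^+ 2 * c.
  have [->|c0] := eqVneq c 0; first by exists 1; rewrite ?oner_eq0 // mulr0 rmorph0.
  exists (sqrtc c)^*; first by rewrite conjC_eq0 sqrtc_eq0.
  by rewrite -{2 4}(sqr_sqrtc c) rmorphM !rmorphXn /= conjCK mulrC.
pose T1 x := w *: T x + (- (w * (t / 2))) *: x.
have idbl : bounded_linear ip (fun x => x).
  by split => //; exists 1 => x; rewrite mul1r.
have T1bl : bounded_linear ip T1 := bounded_linear_comb _ _ Tbl idbl.
have [S [TS _]] := adjoint_exists ipP complete T1bl.
have T1T1 x : T1 (T1 x) = (w ^+ 2 * c) *: x.
  rewrite {1}/T1 /T1 (lopD Tlin) !(lopZ Tlin) TT !scalerDr !scalerA.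
  have gather (a b c' d' e : R[i]) (y z : V) :
      a *: y + b *: z + c' *: y + (d' *: y + e *: z) = (a + c' + d') *: y + (b + e) *: z.
    by rewrite !scalerDl (addrAC (a *: y)) addrACA.
  rewrite gather (_ : _ + _ + _ = 0) ?scale0r ?add0r; last by field.
  by congr (_ *: _); rewrite /c; field.
have := complex_symmetric_affine (w^-1) (t / 2) TS
  (complex_symmetric_real_square T1bl TS wc T1T1).
congr complex_symmetric; apply/funext => x.
by rewrite /T1 scalerDr !scalerA mulVf // scale1r mulrN mulrA mulVf // mul1r
  scaleNr subrK.
Qed.

End Quadratic.

(** * Weighted shifts and sharpness *)

Section WeightedShift.
Variables (R : realType) (V : lmodType R[i]) (ip : V -> V -> R[i]).
Hypothesis ipP : inner_product_axioms ip.

Local Notation nm := (hnorm ip).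

(** Gram-Schmidt with a dimension count: if k < n orthonormal vectors spanned every [v i], the n by
    k coefficient matrix would have a nonzero left kernel vector, contradicting freeness. So some
    [v i] has a nonzero component orthogonal to them, which is normalized. *)
Lemma orthonormal_family n : dim_ge V n -> exists e : nat -> V,
  forall i j, (i < n)%N -> (j < n)%N -> ip (e i) (e j) = (i == j)%:R.
Proof.
move=> [v vfree].
suff : forall k, (k <= n)%N -> exists e : nat -> V,
    forall i j, (i < k)%N -> (j < k)%N -> ip (e i) (e j) = (i == j)%:R.
  by apply.
elim=> [_|k IH kn]; first by exists (fun=> 0).
have [e eE] := IH (ltnW kn).
pose A : 'M[R[i]]_(n, k) := \matrix_(i, j) ip (v i) (e j).
pose u i := v i - \sum_(j < k) A i j *: e j.
have [i ui] : exists i, u i <> 0.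
  apply: contrapT => u0.
  have vE i : v i = \sum_(j < k) A i j *: e j.
    by apply/eqP; rewrite -subr_eq0; apply/eqP; apply: contrapT => ui; apply: u0; exists i.
  have /rowV0Pn[c /sub_kermxP cA c0] : kermx A != 0.
    rewrite kermx_eq0 /row_free; apply: contraL kn => /eqP <-.
    by rewrite -leqNgt rank_leq_col.
  case/eqP: c0; apply/rowP => i; rewrite mxE; move: i; apply: vfree.
  under eq_bigr => i _ do rewrite vE scaler_sumr.
  rewrite exchange_big big1 //= => j _.
  under eq_bigr => i _ do rewrite scalerA.
  rewrite -scaler_suml; move/rowP: cA => /(_ j); rewrite !mxE => ->.
  by rewrite scale0r.
have perp j : (j < k)%N -> ip (u i) (e j) = 0.
  move=> jk; rewrite (ipBl ipP) (ip_suml ipP) (bigD1 (Ordinal jk)) //= big1 ?addr0.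
    by rewrite (ipZl ipP) eE // eqxx mulr1 mxE subrr.
  move=> j' ne; rewrite (ipZl ipP) eE //.
  by rewrite (negbTE (_ : (val j' != j))) ?mulr0.
have uu := rip_gt0 ipP ui.
pose a : R[i] := ((nm (u i))^-1)%:C%C.
exists (fun m => if m == k then a *: u i else e m) => p q.
rewrite !ltnS (leq_eqVlt p) (leq_eqVlt q).
have [-> _|_ /= pk] := eqVneq p k; have [-> _|_ /= qk] := eqVneq q k.
- rewrite (ipZl ipP) (ipZr ipP) (ipxxE ipP) -(nm2 ipP).
  rewrite conjE conjc_real -!(rmorphM (real_complex R)) /=.
  have n0 : nm (u i) != 0 by apply/eqP => /(nm_eq0 ipP).
  by rewrite expr2 mulKf // mulVf.
- by rewrite (ipZl ipP) perp // mulr0.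
- by rewrite (ipZr ipP) (ipC ipP (u i)) perp // rmorph0 mulr0 ltn_eqF.
exact: eE.
Qed.

Variables (N : nat) (e : nat -> V).
Hypothesis eE : forall i j, (i < N.+1)%N -> (j < N.+1)%N ->
  ip (e i) (e j) = (i == j)%:R.

Definition shift_weight k : R[i] := if k == 0%N then 2 else 1.
Local Notation w := shift_weight.

Definition shift x : V := \sum_(k < N) (w k * ip x (e k.+1)) *: e k.
Definition coshift x : V := \sum_(k < N) (w k * ip x (e k)) *: e k.+1.

Lemma shift_weight_neq0 k : w k != 0.
Proof. by rewrite /w; case: ifP; rewrite ?oner_eq0 ?pnatr_eq0. Qed.

Lemma shift_adjoint : is_adjoint ip shift coshift.
Proof.
have wJ k : (w k)^* = w k by rewrite /w; case: ifP => _; rewrite ?rmorph1 ?rmorph_nat.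
move=> x y; rewrite (ip_suml ipP) (ipC ipP) (ip_suml ipP) rmorph_sum.
apply: eq_bigr => k _ /=.
rewrite !(ipZl ipP) !rmorphM /= wJ -!(ipC ipP); ring.
Qed.

Lemma shift_bounded : bounded_linear ip shift.
Proof.
rewrite /shift; elim: N => [|n IH].
  split=> [a x y|]; first by rewrite !big_ord0 scaler0 addr0.
  by exists 0 => x; rewrite big_ord0 (nm0 ipP) mul0r.
(* Each summand has rank one and is bounded by Cauchy-Schwarz. *)
have rank1 : bounded_linear ip (fun x => (w n * ip x (e n.+1)) *: e n).
  split=> [a x y|].
    rewrite (ipDl ipP) (ipZl ipP) mulrDr scalerDl scalerA; congr (_ *: _ + _); ring.
  exists (complex.Re `|w n| * nm (e n.+1) * nm (e n)) => x.
  rewrite (nmZC ipP) mulrAC ler_wpM2r ?nm_ge0 // normrM.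
  have -> : complex.Re (`|w n| * `|ip x (e n.+1)|) =
      complex.Re `|w n| * complex.Re `|ip x (e n.+1)|.
    by rewrite /= mulr0 subr0.
  rewrite -mulrA ler_wpM2l ?Re_norm_ge0 // mulrC; exact: ip_CS.
have := bounded_linear_comb ipP 1 1 IH rank1.
congr bounded_linear; apply/funext => x.
by rewrite !scale1r big_ord_recr.
Qed.

Let Tlin := shift_bounded.1.
Let Slin := adjointP ipP (adjointC ipP shift_adjoint).

Lemma shift0 : shift (e 0) = 0.
Proof.
rewrite /shift big1 // => k _.
by rewrite eE ?ltnS // mulr0 scale0r.
Qed.

Lemma shiftS m : (m < N)%N -> shift (e m.+1) = w m *: e m.
Proof.
move=> mN; rewrite /shift (bigD1 (Ordinal mN)) //= big1 ?addr0.
  by rewrite eE // eqxx mulr1.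
move=> k ne; rewrite eE ?ltnS // eqSS eq_sym.
by rewrite (negbTE (_ : (val k != m))) // mulr0 scale0r.
Qed.

Lemma coshiftE m : (m < N)%N -> coshift (e m) = w m *: e m.+1.
Proof.
move=> mN; rewrite /coshift (bigD1 (Ordinal mN)) //= big1 ?addr0.
  by rewrite eE ?(leqW mN) // eqxx mulr1.
move=> k ne; rewrite eE ?ltnS ?(ltnW mN) ?(ltnW (ltn_ord k)) // eq_sym.
by rewrite (negbTE (_ : (val k != m))) // mulr0 scale0r.
Qed.

Lemma iter_shift i m : (i <= m)%N -> (m <= N)%N ->
  exists2 c : R[i], c != 0 & iter i shift (e m) = c *: e (m - i)%N.
Proof.
elim: i => [|i IH] im mN; first by exists 1; rewrite ?oner_eq0 // scale1r subn0.
have [c c0 /= ->] := IH (ltnW im) mN.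
exists (c * w (m - i.+1)%N); first by rewrite mulf_neq0 ?shift_weight_neq0.
rewrite (lopZ Tlin) -(subnSK im) shiftS ?scalerA //.
by rewrite subnSK // (leq_trans (leq_subr _ _)).
Qed.

Lemma iter_coshift i : (i <= N)%N ->
  exists2 c : R[i], c != 0 & iter i coshift (e 0) = c *: e i.
Proof.
elim: i => [|i IH] iN; first by exists 1; rewrite ?oner_eq0 // scale1r.
have [c c0 /= ->] := IH (ltnW iN).
exists (c * w i); first by rewrite mulf_neq0 ?shift_weight_neq0.
by rewrite (lopZ Slin) coshiftE // scalerA.
Qed.

(** The first shift lands in the span of e_0, ..., e_(N-1) for arbitrary x, and each further one
    kills e_0 and lowers the others. At i = N the range is the line of e_0, which gives nilpotency
    and later locates C e_0. *)
Lemma iter_shift_span i x : (0 < i <= N)%N ->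
  exists a : nat -> R[i], iter i shift x = \sum_(k < N.+1 - i) a k *: e k.
Proof.
elim: i => // -[_ _|i IH /andP[_ iN]].
  by exists (fun k => w k * ip x (e k.+1)); rewrite subn1.
have [|a aE] := IH; first exact: ltnW.
exists (fun k => a k.+1 * w k).
rewrite iterS aE.
have -> : (N.+1 - i.+1 = (N.+1 - i.+2).+1)%N by rewrite (subnSK (leqW iN)).
have shift_sum n (F : 'I_n -> V) : shift (\sum_k F k) = \sum_k shift (F k).
  by apply: (big_morph _ (lopD Tlin) (lop0 Tlin)).
rewrite shift_sum big_ord_recl (lopZ Tlin) shift0 scaler0 add0r.
apply: eq_bigr => k _; rewrite (lopZ Tlin) /= /bump /= add1n shiftS ?scalerA //.
apply: leq_trans (ltn_ord k) _; exact: leq_subr.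
Qed.

Lemma shift_degree : (0 < N)%N -> algebraic_of_degree shift N.+1.
Proof.
move=> N0; split.
  exists 'X^(N.+1); rewrite monic_neq0 ?monicXn // size_polyXn; split => //; split => //.
  move=> x; rewrite /poly_op size_polyXn big_ord_recr big1 ?add0r /=.
    rewrite coefXn eqxx scale1r -iterS.
    have [|a] := @iter_shift_span N x; first by rewrite N0 leqnn.
    rewrite subSnn big_ord1 iterS => ->.
    by rewrite add0r (lopZ Tlin) shift0 scaler0.
  by move=> k _; rewrite coefXn ltn_eqF ?scale0r //= ltn_ord.
move=> q q0 qT; rewrite leqNgt; apply/negP => lt_q.
have sq : (0 < size q)%N by rewrite size_poly_gt0.
have Hq := qT (e N); move: Hq; rewrite /poly_op.
set d := (size q).-1 in lt_q *.
have coefE (k : 'I_(size q)) : exists2 c : R[i], c != 0 & iter k shift (e N) = c *: e (N - k)%N.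
  apply: iter_shift => //.
  by rewrite -ltnS; apply: leq_trans (ltn_ord k) _; rewrite -(prednK sq).
have dlt : (d < size q)%N by rewrite /d ltn_predL.
(* The powers of the shift send e_N to nonzero multiples of distinct e_(N-k), so this product
   isolates the leading coefficient of [q]. *)
move=> /(congr1 (fun v => ip v (e (N - d)%N))).
rewrite (ip0l ipP) (ip_suml ipP) (bigD1 (Ordinal dlt)) //= big1 ?addr0.
  have [c c0 /= ->] := coefE (Ordinal dlt).
  rewrite !(ipZl ipP) eE ?ltnS ?leq_subr // eqxx mulr1 => /eqP.
  by rewrite mulf_eq0 (negbTE c0) orbF -lead_coefE lead_coef_eq0 (negbTE q0).
move=> k ne; have [c _ ->] := coefE k.
rewrite !(ipZl ipP) eE ?ltnS ?leq_subr // (_ : _ == _ = false) ?mulr0 //.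
apply: contraNF ne => /eqP H; apply/eqP/val_inj => /=.
have kN : (k <= N)%N by rewrite -ltnS; apply: leq_trans (ltn_ord k) _; rewrite -(prednK sq).
by rewrite -(subKn kN) H subKn.
Qed.

Lemma shift_not_complex_symmetric : (1 < N)%N -> ~ complex_symmetric ip shift.
Proof.
move=> N1 [C [[Clin Cnm CC] [S' [TS' TE]]]].
have N0 := ltnW N1.
have SE y : S' y = coshift y.
  apply: (ip_ext ipP) => x; apply/(can_inj conjCK).
  by rewrite -!(ipC ipP) -TS' shift_adjoint.
have C0 : C 0 = 0.
  by have := Clin (-1) 0 0; rewrite scaler0 addr0 rmorphN rmorph1 scaleN1r addNr.
have CZ c y : C (c *: y) = c^* *: C y by have := Clin c y 0; rewrite C0 !addr0.
have TC x : shift (C x) = C (coshift x) by rewrite TE CC SE.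
have TCi i x : iter i shift (C x) = C (iter i coshift x).
  by elim: i => //= i ->; rewrite TC.
(* T^N (C e_0) lies on the line of e_0 and equals C (c e_N); applying C shows that C e_0 is a
   multiple of e_N. *)
have [c c0 Sc] := iter_coshift (leqnn N).
have [|a] := @iter_shift_span N (C (e 0)); first by rewrite N0 leqnn.
rewrite subSnn big_ord1 TCi Sc => /(congr1 C); rewrite CC CZ /= => ceN.
have Ce0 : C (e 0) = ((a 0%N)^*^-1 * c) *: e N.
  have a0 : (a 0%N)^* != 0.
    apply/eqP => a0; move: ceN; rewrite a0 scale0r => /eqP.
    rewrite scaler_eq0 (negbTE c0) => /eqP eN0.
    have := eE (leqnn N.+1) (leqnn N.+1); rewrite eN0 (ip0l ipP) eqxx => /eqP.
    by rewrite eq_sym oner_eq0.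
  by rewrite -scalerA ceN scalerA mulVf // scale1r.
move: (_^-1 * c) Ce0 => d Ce0.
have nme m : (m <= N)%N -> nm (e m) = 1.
  by move=> mN; rewrite /hnorm eE ?ltnS // eqxx /= sqrtr1.
have d1 : complex.Re `|d| = 1.
  by have := Cnm (e 0); rewrite Ce0 (nmZC ipP) !nme // mulr1.
(* Norms in T (C e_0) = C (S e_0): the left side gives w_(N-1) = 1, as N - 1 is nonzero, and the
   right side gives w_0 = 2. *)
have := congr1 nm (TC (e 0)).
rewrite Ce0 (lopZ Tlin) Cnm coshiftE // -[in LHS](prednK N0) shiftS ?prednK //.
rewrite !(nmZC ipP) d1 !nme ?leq_pred // !mulr1 mul1r /shift_weight eqxx.
have -> : (N.-1 == 0)%N = false by case: (N) N1 => [|[]].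
rewrite normr1 normr_nat /= => /eqP.
by rewrite -subr_eq0 opprD addrA subrr add0r oppr_eq0 oner_eq0.
Qed.

End WeightedShift.

Theorem theorem3p2 :
  (forall (R : realType) (V : lmodType R[i]) (ip : V -> V -> R[i]),
     separable_hilbert ip ->
     forall T : V -> V, bounded_linear ip T ->
       algebraic_degree_le T 2 -> complex_symmetric ip T)
  /\
  (forall n : nat, (3 <= n)%N ->
     forall (R : realType) (V : lmodType R[i]) (ip : V -> V -> R[i]),
       separable_hilbert ip -> dim_ge V n ->
       exists T : V -> V, [/\ bounded_linear ip T,
                             algebraic_of_degree T n &
                             ~ complex_symmetric ip T]).
Proof.
(* The shift acts on n = N + 1 vectors, so 3 <= n provides 1 < N. *)
split=> [R V ip [ipP complete _] T|[//|N] N2 R V ip [ipP _ _] Vdim].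
  exact: complex_symmetric_quadratic.
have [e eE] := orthonormal_family ipP Vdim.
exists (shift ip N e); split.
- exact: shift_bounded.
- by apply: shift_degree => //; exact: ltnW.
exact: shift_not_complex_symmetric.
Qed.
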